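(* Let $\theta=\sqrt{b/a}$ with $a<b$ coprime positive integers not both perfect squares. For all $C,D>0$ there exist $\varepsilon>\eta>C$ with $\varepsilon-\eta<D$ such that $$0=\liminf_{B\to\infty}\delta_{\theta,B,1/2}(\chi_{\varepsilon,\eta})<\limsup_{B\to\infty}\delta_{\theta,B,1/2}(\chi_{\varepsilon,\eta})=O_{\varepsilon,\eta}(1).$$ In particular, the measures $\delta_{\theta,B,1/2}$ have no limit measure as $B\to\infty$.
   Context: On $\mathbb{P}^1(\mathbb{Q})$ use the height $H([u:v])=\max(|u|,|v|)$ with $u,v$ coprime integers. For a real number $\theta$, $r>0$, $B>0$ and $f$ a compactly supported function on $\mathbb{R}$, set $\delta_{\theta,B,r}(f)=\sum_{[u:v]\in\mathbb{P}^1(\mathbb{Q}),\,v\ne0,\,H([u:v])\le B}f\big(B^{1/r}(u/v-\theta)\big)$. For $\varepsilon>\eta\ge0$, $\chi_{\varepsilon,\eta}$ is the indicator function of $\{t\in\mathbb{R}:\eta<|t|\le\varepsilon\}$ and $\chi_\varepsilon=\chi_{\varepsilon,0}$ is that of $\{|t|\le\varepsilon\}$. *)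

(* Defs.v *)
From Stdlib Require Import Reals Lra Lia ZArith List.
Open Scope R_scope.

Definition chi (eps eta : R) (t : R) : R :=
  if Rlt_dec eta (Rabs t) then (if Rle_dec (Rabs t) eps then 1 else 0) else 0.

Definition Zsym (N : nat) : list Z :=
  map (fun k => (Z.of_nat k - Z.of_nat N)%Z) (seq 0 (2 * N + 1)).
Definition Zpos_upto (N : nat) : list Z :=
  map (fun k => Z.of_nat k) (seq 1 N).

(* delta_{theta,B,r}(f) = sum over [u:v] in P^1(Q), v <> 0, H([u:v]) <= B of
   f(B^(1/r) (u/v - theta)).  Each such point has a unique representative
   (u,v) with u,v coprime integers and v > 0; H = max(|u|,|v|). *)
Definition delta (theta B r : R) (f : R -> R) : R :=
  let N := Z.to_nat (up B) in
  fold_right Rplus 0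
    (map (fun p : Z * Z =>
            let (u, v) := p in
            if (Z.eqb (Z.gcd u v) 1)%Z then
              (if Rle_dec (Rmax (Rabs (IZR u)) (Rabs (IZR v))) B then
                 f (Rpower B (1 / r) * (IZR u / IZR v - theta))
               else 0)
            else 0)
         (list_prod (Zsym N) (Zpos_upto N))).

Definition liminf_infty_eq (g : R -> R) (l : R) : Prop :=
  (forall e, 0 < e -> forall M, exists B, M <= B /\ g B < l + e) /\
  (forall e, 0 < e -> exists M, forall B, M <= B -> l - e < g B).

Definition limsup_infty_eq (g : R -> R) (l : R) : Prop :=
  (forall e, 0 < e -> forall M, exists B, M <= B /\ l - e < g B) /\
  (forall e, 0 < e -> exists M, forall B, M <= B -> g B < l + e).

(* Main.v *)
Require Import Defs.
From Stdlib Require Import Reals ZArith.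
From Stdlib Require Import Lra Lia List Znumtheory Classical.
Open Scope R_scope.

(* Write g(B) for delta_{th,B,1/2}(chi_{eps,eta}): it counts the reduced fractions u/v
   with |u|, v <= B and eta < B^2 |u/v - th| <= eps.  Two such fractions are at least
   1/B^2 apart and lie in an interval of length 2 eps/B^2, so g is bounded.  Dirichlet's
   theorem gives fractions with v^2 |u/v - th| < 1, and each of them is counted at the
   scale B with B^2 |u/v - th| = eps, so g(B) >= 1 for arbitrarily large B.  On the other
   hand a fixed fraction is counted only while B^2 stays in a window of ratio eps/eta;
   when this ratio is below 1 + 1/M, M = ceil(8 eps), the scales T (1 + j/M), j <= M,
   would each need their own fraction within 4 eps/(2T)^2 of th with denominator <= 2T,
   and there are at most M of those.  So g vanishes for arbitrarily large B, while being
   integer valued, bounded and frequently >= 1 it has a positive finite limsup. *)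

Lemma NoDup_list_prod {A B : Type} (l : list A) (l' : list B) :
  NoDup l -> NoDup l' -> NoDup (list_prod l l').
Proof.
  intros Hl Hl'. induction Hl as [|x l Hx Hl IH]; simpl; [constructor|].
  apply NoDup_app; auto.
  - apply NoDup_map_NoDup_ForallPairs; auto. intros y z _ _ E. congruence.
  - intros [u v] Hin Hin'. apply in_map_iff in Hin. destruct Hin as [y [E _]].
    injection E as <- <-. apply in_prod_iff in Hin'. tauto.
Qed.

Lemma sum_indicator {A : Type} (t : A -> R) (l : list A) :
  (forall x, t x = 0 \/ t x = 1) ->
  fold_right Rplus 0 (map t l) =
  INR (length (filter (fun x => if Req_EM_T (t x) 0 then false else true) l)).
Proof.
  intros H01. induction l as [|x l IH]; simpl; [reflexivity|].
  rewrite IH. destruct (Req_EM_T (t x) 0) as [E|E].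
  - rewrite E. ring.
  - destruct (H01 x) as [E'|E']; [contradiction|]. rewrite E'. simpl length.
    rewrite S_INR. ring.
Qed.

Lemma Int_part_eq_close x y : Int_part x = Int_part y -> Rabs (x - y) < 1.
Proof.
  intros E. destruct (base_Int_part x), (base_Int_part y). rewrite E in *.
  apply Rabs_def1; lra.
Qed.

(* Pigeonhole on the unit cells [k, k + 1), k < K. *)
Lemma separated_length_le {A : Type} (l : list A) (f : A -> R) (K : nat) :
  NoDup l ->
  (forall x y, In x l -> In y l -> Rabs (f x - f y) < 1 -> x = y) ->
  (forall x, In x l -> 0 <= f x < INR K) ->
  (length l <= K)%nat.
Proof.
  intros Hnd Hsep Hrange.
  set (cell := fun x => Int_part (f x)).
  assert (Hcells : NoDup (map cell l)).
  { apply NoDup_map_NoDup_ForallPairs; auto.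
    intros x y Hx Hy E. apply Hsep; auto. apply Int_part_eq_close, E. }
  assert (Hincl : incl (map cell l) (map Z.of_nat (seq 0 K))).
  { intros z Hz. apply in_map_iff in Hz. destruct Hz as [x [<- Hx]].
    destruct (Hrange x Hx) as [Hf0 HfK]. destruct (base_Int_part (f x)) as [Hfl Hfl'].
    assert (Hlo : (-1 < cell x)%Z) by (apply lt_IZR; unfold cell; lra).
    assert (Hhi : (cell x < Z.of_nat K)%Z)
      by (apply lt_IZR; rewrite <- INR_IZR_INZ; unfold cell; lra).
    apply in_map_iff. exists (Z.to_nat (cell x)).
    split; [apply Z2Nat.id; lia | apply in_seq; lia]. }
  pose proof (NoDup_incl_length Hcells Hincl) as Hlen.
  rewrite !length_map, length_seq in Hlen. exact Hlen.
Qed.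

Lemma IZR_le_INR_to_nat (z : Z) : IZR z <= INR (Z.to_nat z).
Proof.
  destruct (Z_le_gt_dec 0 z).
  - rewrite INR_IZR_INZ, Z2Nat.id by lia. lra.
  - pose proof (pos_INR (Z.to_nat z)). assert (IZR z < 0) by (apply IZR_lt; lia). lra.
Qed.

Lemma Rabs_le_sqrt (x y : R) : x * x <= y -> Rabs x <= sqrt y.
Proof. intros H. rewrite <- sqrt_Rsqr_abs. apply sqrt_le_1_alt. exact H. Qed.

Lemma coprime_fraction_gap (u v u' v' : Z) (Q : R) :
  Z.gcd u v = 1%Z -> Z.gcd u' v' = 1%Z -> (1 <= v)%Z -> (1 <= v')%Z ->
  IZR v <= Q -> IZR v' <= Q ->
  Rabs (IZR u / IZR v - IZR u' / IZR v') * (Q * Q) < 1 -> (u, v) = (u', v').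
Proof.
  intros g g' hv hv' hvQ hv'Q Hclose.
  assert (Hv : 1 <= IZR v) by (apply IZR_le; lia).
  assert (Hv' : 1 <= IZR v') by (apply IZR_le; lia).
  set (cross := (u * v' - v * u')%Z).
  assert (Hcross : Rabs (IZR u / IZR v - IZR u' / IZR v') * (IZR v * IZR v')
                   = Rabs (IZR cross)).
  { rewrite <- (Rabs_right (IZR v * IZR v')) by nra. rewrite <- Rabs_mult.
    f_equal. unfold cross. rewrite minus_IZR, !mult_IZR. field. lra. }
  destruct (Z.eq_dec cross 0) as [E|E].
  - apply Zgcd_1_rel_prime in g, g'.
    destruct (rel_prime_cross_prod u v u' v' g g') as [-> ->]; auto; lia.
  - exfalso.
    assert (1 <= Rabs (IZR cross)) by (rewrite <- abs_IZR; apply IZR_le; lia).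
    pose proof (Rabs_pos (IZR u / IZR v - IZR u' / IZR v')).
    assert (IZR v * IZR v' <= Q * Q) by (apply Rmult_le_compat; lra).
    nra.
Qed.

Lemma near_coprime_fractions_length (th Q c : R) (l : list (Z * Z)) :
  NoDup l ->
  (forall u v, In (u, v) l -> Z.gcd u v = 1%Z /\ (1 <= v)%Z /\ IZR v <= Q /\
     Rabs (IZR u / IZR v - th) * (Q * Q) <= c) ->
  (length l <= Z.to_nat (up (2 * c)))%nat.
Proof.
  intros Hnd Hl.
  set (pos := fun p : Z * Z => let (u, v) := p in (IZR u / IZR v - th) * (Q * Q) + c).
  assert (HQ : 0 <= Q * Q) by nra.
  apply (separated_length_le l pos); auto.
  - intros [u v] [u' v'] Hx Hy Hsep.
    destruct (Hl u v Hx) as (g & hv & hvQ & _), (Hl u' v' Hy) as (g' & hv' & hv'Q & _).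
    apply (coprime_fraction_gap _ _ _ _ Q); auto. simpl in Hsep.
    replace ((IZR u / IZR v - th) * (Q * Q) + c - ((IZR u' / IZR v' - th) * (Q * Q) + c))
      with ((IZR u / IZR v - IZR u' / IZR v') * (Q * Q)) in Hsep by ring.
    rewrite Rabs_mult, (Rabs_right (Q * Q)) in Hsep by lra. exact Hsep.
  - intros [u v] Hx. destruct (Hl u v Hx) as (_ & _ & _ & Hd). simpl.
    set (e := (IZR u / IZR v - th) * (Q * Q)).
    assert (He : Rabs e <= c) by (unfold e; rewrite Rabs_mult, (Rabs_right (Q * Q)); lra).
    pose proof (Rle_abs e) as He1. pose proof (Rle_abs (- e)) as He2. rewrite Rabs_Ropp in He2.
    destruct (archimed (2 * c)) as [Hup _].
    pose proof (IZR_le_INR_to_nat (up (2 * c))). lra.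
Qed.

Lemma lowest_terms (p q : Z) : (0 < q)%Z ->
  exists g u v, (0 < g)%Z /\ (0 < v)%Z /\ Z.gcd u v = 1%Z /\
    p = (g * u)%Z /\ q = (g * v)%Z.
Proof.
  intros hq. set (g := Z.gcd p q).
  assert (hg : (0 < g)%Z).
  { pose proof (Z.gcd_nonneg p q).
    assert (g <> 0%Z) by (intro z; apply Z.gcd_eq_0_r in z; lia). lia. }
  destruct (Z.gcd_divide_l p q) as [u Hu], (Z.gcd_divide_r p q) as [v Hv].
  fold g in Hu, Hv. exists g, u, v. repeat split; try lia.
  pose proof (Z.gcd_div_gcd p q g ltac:(lia) eq_refl) as G.
  rewrite Hu, Hv, !Z.div_mul in G by lia. exact G.
Qed.

Lemma dirichlet_approx (th : R) (n : nat) : (1 <= n)%nat ->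
  exists p q : Z, (1 <= q <= Z.of_nat n)%Z /\ Rabs (IZR q * th - IZR p) < 1 / INR n.
Proof.
  intros hn. assert (Hn : 1 <= INR n) by (apply (le_INR 1); auto).
  set (pos := fun k : nat => INR n * frac_part (INR k * th)).
  assert (Hclose : forall k k', (k < k' <= n)%nat -> Rabs (pos k' - pos k) < 1 ->
    exists p q : Z, (1 <= q <= Z.of_nat n)%Z /\ Rabs (IZR q * th - IZR p) < 1 / INR n).
  { intros k k' hk Hkk'.
    exists (Int_part (INR k' * th) - Int_part (INR k * th))%Z, (Z.of_nat k' - Z.of_nat k)%Z.
    split; [lia|]. rewrite !minus_IZR, <- !INR_IZR_INZ.
    replace ((INR k' - INR k) * th - (IZR (Int_part (INR k' * th)) - IZR (Int_part (INR k * th))))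
      with ((pos k' - pos k) / INR n) by (unfold pos, frac_part; field; lra).
    unfold Rdiv. rewrite Rabs_mult, (Rabs_right (/ INR n))
      by (apply Rle_ge, Rlt_le, Rinv_0_lt_compat; lra).
    apply Rmult_lt_compat_r; [apply Rinv_0_lt_compat; lra | exact Hkk']. }
  apply NNPP. intros Hnone.
  assert (Hlen : (length (seq 0 (S n)) <= n)%nat).
  { apply (separated_length_le _ pos); [apply seq_NoDup| |].
    - intros k k' Hk Hk' Hkk'. apply in_seq in Hk, Hk'.
      destruct (Nat.lt_total k k') as [lt|[eq|lt]]; auto; exfalso; apply Hnone.
      + apply (Hclose k k'); [lia|]. rewrite Rabs_minus_sym. exact Hkk'.
      + apply (Hclose k' k); [lia|exact Hkk'].
    - intros k _. unfold pos. destruct (base_fp (INR k * th)). split; nra. }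
  rewrite length_seq in Hlen. lia.
Qed.

Lemma dirichlet_approx_coprime (th : R) (n : nat) : (1 <= n)%nat ->
  exists u v : Z, Z.gcd u v = 1%Z /\ (1 <= v <= Z.of_nat n)%Z /\
    Rabs (IZR v * th - IZR u) < 1 / INR n.
Proof.
  intros hn. destruct (dirichlet_approx th n hn) as (p & q & hq & Hpq).
  destruct (lowest_terms p q ltac:(lia)) as (g & u & v & hg & hv & G & -> & ->).
  exists u, v. split; [exact G|]. split; [nia|].
  assert (Hg : 1 <= IZR g) by (apply IZR_le; lia).
  rewrite !mult_IZR in Hpq.
  replace (IZR g * IZR v * th - IZR g * IZR u) with (IZR g * (IZR v * th - IZR u)) in Hpq
    by ring.
  rewrite Rabs_mult, (Rabs_right (IZR g)) in Hpq by lra.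
  pose proof (Rabs_pos (IZR v * th - IZR u)). nra.
Qed.

Lemma Z_gcd_sqr_1 (u v : Z) : Z.gcd u v = 1%Z -> Z.gcd (u * u) (v * v) = 1%Z.
Proof.
  rewrite !Zgcd_1_rel_prime. intros g.
  apply rel_prime_sym, rel_prime_mult; apply rel_prime_sym, rel_prime_mult; exact g.
Qed.

Lemma sqrt_ratio_irrational (a b : Z) : (0 < a)%Z -> (0 < b)%Z -> Z.gcd a b = 1%Z ->
  ~ ((exists x : Z, a = (x * x)%Z) /\ (exists y : Z, b = (y * y)%Z)) ->
  forall p q : Z, (0 < q)%Z -> IZR p / IZR q <> sqrt (IZR b / IZR a).
Proof.
  intros ha hb hab hsq p q hq E.
  destruct (lowest_terms p q hq) as (g & u & v & hg & hv & G & -> & ->).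
  assert (Ha : 0 < IZR a) by (apply IZR_lt; auto).
  assert (Hb : 0 < IZR b) by (apply IZR_lt; auto).
  assert (Hv : 0 < IZR v) by (apply IZR_lt; auto).
  assert (Hg : 0 < IZR g) by (apply IZR_lt; auto).
  assert (Hsq : (IZR u / IZR v) * (IZR u / IZR v) = IZR b / IZR a).
  { replace (IZR u / IZR v) with (IZR (g * u) / IZR (g * v))
      by (rewrite !mult_IZR; field; lra).
    rewrite E. apply sqrt_sqrt. left. apply Rdiv_lt_0_compat; auto. }
  assert (Euv : (a * (u * u) = b * (v * v))%Z).
  { apply eq_IZR. rewrite !mult_IZR.
    replace (IZR a * (IZR u * IZR u))
      with ((IZR u / IZR v) * (IZR u / IZR v) * (IZR a * (IZR v * IZR v))) by (field; lra).
    rewrite Hsq. field. lra. }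
  pose proof (Z_gcd_sqr_1 u v G) as G2.
  apply hsq. split.
  - exists v. apply Z.divide_antisym_nonneg; [lia|nia| |].
    + apply Z.gauss with b; [exists (u * u)%Z; lia | exact hab].
    + apply Z.gauss with (u * u)%Z; [exists b; lia | rewrite Z.gcd_comm; exact G2].
  - exists u. apply Z.divide_antisym_nonneg; [lia|nia| |].
    + apply Z.gauss with a; [exists (v * v)%Z; lia | rewrite Z.gcd_comm; exact hab].
    + apply Z.gauss with (v * v)%Z; [exists a; lia | exact G2].
Qed.

Lemma liminf_zero_of_nat_valued (g : R -> R) (c : R -> nat) :
  (forall B, g B = INR (c B)) ->
  (forall M, exists B, M <= B /\ c B = 0%nat) -> liminf_infty_eq g 0.
Proof.
  intros Hg Hzero. split.
  - intros e he M. destruct (Hzero M) as [B [hB E]]. exists B. rewrite Hg, E. simpl. lra.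
  - intros e he. exists 0. intros B _. rewrite Hg. pose proof (pos_INR (c B)). lra.
Qed.

Lemma exists_last_true (P : nat -> Prop) (K : nat) :
  P 1%nat -> ~ P (S K) -> exists n, (1 <= n)%nat /\ P n /\ ~ P (S n).
Proof.
  intros H1. induction K as [|K IH]; intros HK; [contradiction|].
  destruct (classic (P (S K))) as [HSK|HSK].
  - exists (S K). split; [lia | auto].
  - apply IH, HSK.
Qed.

(* The limsup is the largest level n that c reaches for arbitrarily large B. *)
Lemma limsup_pos_of_nat_valued (g : R -> R) (c : R -> nat) (K : nat) :
  (forall B, g B = INR (c B)) -> (forall B, (c B <= K)%nat) ->
  (forall M, exists B, M <= B /\ (1 <= c B)%nat) ->
  exists L, 0 < L /\ limsup_infty_eq g L.
Proof.
  intros Hg HK Hone.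
  set (P := fun n => forall M, exists B, M <= B /\ (n <= c B)%nat).
  assert (PK : ~ P (S K)).
  { intros HP. destruct (HP 0) as [B [_ hB]]. specialize (HK B). lia. }
  destruct (exists_last_true P K Hone PK) as (n & hn & Pn & Pn').
  exists (INR n). split; [apply lt_0_INR; lia|]. split.
  - intros e he M. destruct (Pn M) as [B [hB hc]]. exists B. split; [exact hB|].
    rewrite Hg. apply le_INR in hc. lra.
  - intros e he. apply not_all_ex_not in Pn'. destruct Pn' as [M HM].
    exists M. intros B hB. rewrite Hg.
    assert (hc : (c B <= n)%nat).
    { destruct (Nat.le_gt_cases (c B) n) as [|Hgt]; [assumption|].
      exfalso. apply HM. exists B. split; [exact hB | lia]. }
    apply le_INR in hc. lra.
Qed.

Definition delta_pairs (B : R) : list (Z * Z) :=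
  list_prod (Zsym (Z.to_nat (up B))) (Zpos_upto (Z.to_nat (up B))).

Definition delta_summand (th B r : R) (f : R -> R) (p : Z * Z) : R :=
  let (u, v) := p in
  if Z.eqb (Z.gcd u v) 1 then
    (if Rle_dec (Rmax (Rabs (IZR u)) (Rabs (IZR v))) B then
       f (Rpower B (1 / r) * (IZR u / IZR v - th))
     else 0)
  else 0.

Lemma delta_as_sum th B r f :
  delta th B r f = fold_right Rplus 0 (map (delta_summand th B r f) (delta_pairs B)).
Proof. reflexivity. Qed.

Lemma NoDup_delta_pairs B : NoDup (delta_pairs B).
Proof.
  apply NoDup_list_prod; apply NoDup_map_NoDup_ForallPairs; try apply seq_NoDup;
    intros x y _ _ E; lia.
Qed.

Lemma In_delta_pairs_denom B u v : In (u, v) (delta_pairs B) -> (1 <= v)%Z.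
Proof.
  unfold delta_pairs, Zpos_upto. rewrite in_prod_iff, in_map_iff.
  intros [_ [k [<- Hk]]]. apply in_seq in Hk. lia.
Qed.

Lemma In_delta_pairs B u v : (1 <= v)%Z -> IZR v <= B -> Rabs (IZR u) <= B ->
  In (u, v) (delta_pairs B).
Proof.
  intros hv hvB huB. destruct (archimed B) as [HupB _].
  assert (Hvu : (v < up B)%Z) by (apply lt_IZR; lra).
  assert (Huu : (Z.abs u < up B)%Z) by (apply lt_IZR; rewrite abs_IZR; lra).
  assert (EN : Z.of_nat (Z.to_nat (up B)) = up B) by (apply Z2Nat.id; lia).
  unfold delta_pairs, Zsym, Zpos_upto. rewrite in_prod_iff, !in_map_iff. split.
  - exists (Z.to_nat (u + up B)). split; [lia | apply in_seq; lia].
  - exists (Z.to_nat v). split; [lia | apply in_seq; lia].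
Qed.

Definition counted (th eps eta B : R) (u v : Z) : Prop :=
  Z.gcd u v = 1%Z /\ (1 <= v)%Z /\ Rabs (IZR u) <= B /\ IZR v <= B /\
  eta < Rabs (IZR u / IZR v - th) * (B * B) <= eps.

Lemma Rpower_inv_half B : 0 < B -> Rpower B (1 / (1 / 2)) = B * B.
Proof.
  intros hB. replace (1 / (1 / 2)) with (INR 2) by (simpl; field).
  rewrite Rpower_pow by exact hB. simpl. ring.
Qed.

Lemma delta_summand_chi_01 th eps eta B p :
  delta_summand th B (1 / 2) (chi eps eta) p = 0 \/
  delta_summand th B (1 / 2) (chi eps eta) p = 1.
Proof.
  destruct p as [u v]. unfold delta_summand, chi.
  repeat match goal with |- context [if ?c then _ else _] => destruct c end; auto.
Qed.

Lemma delta_summand_chi_neq0 th eps eta B u v : (1 <= v)%Z ->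
  delta_summand th B (1 / 2) (chi eps eta) (u, v) <> 0 <-> counted th eps eta B u v.
Proof.
  intros hv. assert (Hv : 1 <= IZR v) by (apply IZR_le; exact hv).
  unfold delta_summand, chi, counted. rewrite (Rabs_right (IZR v)) by lra.
  destruct (Z.gcd u v =? 1)%Z eqn:G; [apply Z.eqb_eq in G | apply Z.eqb_neq in G].
  2: { split; [intros H; exfalso; apply H; reflexivity | intros [G' _]; contradiction]. }
  destruct (Rle_dec (Rmax (Rabs (IZR u)) (IZR v)) B) as [HB|HB].
  2: { split; [intros H; exfalso; apply H; reflexivity|].
       intros (_ & _ & Hu & HvB & _). exfalso. apply HB, Rmax_lub; assumption. }
  pose proof (Rmax_l (Rabs (IZR u)) (IZR v)) as Hmu.
  pose proof (Rmax_r (Rabs (IZR u)) (IZR v)) as Hmv.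
  rewrite Rpower_inv_half, Rabs_mult, (Rabs_right (B * B)), Rmult_comm by nra.
  repeat match goal with |- context [if ?c then _ else _] => destruct c end;
    split; intros Hc;
    solve [ repeat split; (assumption || lra) | lra | destruct Hc as (_ & _ & _ & _ & [? ?]); lra ].
Qed.

Definition counted_pairs (th eps eta B : R) : list (Z * Z) :=
  filter (fun p => if Req_EM_T (delta_summand th B (1 / 2) (chi eps eta) p) 0
                   then false else true)
    (delta_pairs B).

Lemma delta_chi_length th eps eta B :
  delta th B (1 / 2) (chi eps eta) = INR (length (counted_pairs th eps eta B)).
Proof. rewrite delta_as_sum. apply sum_indicator, delta_summand_chi_01. Qed.

Lemma NoDup_counted_pairs th eps eta B : NoDup (counted_pairs th eps eta B).
Proof. apply NoDup_filter, NoDup_delta_pairs. Qed.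

Lemma In_counted_pairs th eps eta B u v :
  In (u, v) (counted_pairs th eps eta B) <-> counted th eps eta B u v.
Proof.
  unfold counted_pairs. rewrite filter_In. split.
  - intros [Hin Hnz]. apply delta_summand_chi_neq0; [eapply In_delta_pairs_denom; eauto|].
    destruct Req_EM_T; [discriminate | assumption].
  - intros Hc. pose proof Hc as (_ & hv & Hu & Hv & _). split.
    + apply In_delta_pairs; assumption.
    + destruct Req_EM_T as [E|E]; [|reflexivity].
      exfalso. apply (proj2 (delta_summand_chi_neq0 th eps eta B u v hv) Hc E).
Qed.

Lemma counted_pairs_length_le th eps eta B :
  (length (counted_pairs th eps eta B) <= Z.to_nat (up (2 * eps)))%nat.
Proof.
  apply (near_coprime_fractions_length th B); [apply NoDup_counted_pairs|].
  intros u v Hin. apply In_counted_pairs in Hin. destruct Hin as (g & hv & _ & HvB & _ & Hd).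
  repeat split; assumption.
Qed.

Lemma counted_scale_gap th eps eta B B' u v :
  counted th eps eta B u v -> counted th eps eta B' u v -> B' * B' * eta < B * B * eps.
Proof.
  intros (_ & hv & _ & HvB & Hlo & _) (_ & _ & _ & HvB' & _ & Hhi).
  assert (Hv : 1 <= IZR v) by (apply IZR_le; exact hv).
  set (d := Rabs (IZR u / IZR v - th)) in *.
  assert (HB' : 0 < B' * B') by nra. assert (HB : 0 <= B * B) by nra.
  assert (eta * (B' * B') < d * (B * B) * (B' * B')) by (apply Rmult_lt_compat_r; auto).
  assert (d * (B' * B') * (B * B) <= eps * (B * B)) by (apply Rmult_le_compat_r; auto).
  lra.
Qed.

Lemma grid_growth (T m x y : R) : 1 <= m -> 0 <= x <= m -> x + 1 <= y ->
  (T * (1 + x / m)) * (T * (1 + x / m)) * (m + 1) <=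
  (T * (1 + y / m)) * (T * (1 + y / m)) * m.
Proof.
  intros hm hx hy.
  assert (Hpoly : (m + x) * (m + x) * (m + 1) <= (m + y) * (m + y) * m).
  { assert ((m + x + 1) * (m + x + 1) <= (m + y) * (m + y)) by nra.
    assert ((m + x) * (m + x) <= 2 * m * (m + x)) by nra.
    nra. }
  replace ((T * (1 + x / m)) * (T * (1 + x / m)) * (m + 1))
    with ((m + x) * (m + x) * (m + 1) * (T * T / (m * m))) by (field; lra).
  replace ((T * (1 + y / m)) * (T * (1 + y / m)) * m)
    with ((m + y) * (m + y) * m * (T * T / (m * m))) by (field; lra).
  apply Rmult_le_compat_r; [|exact Hpoly].
  apply Rmult_le_pos; [nra | left; apply Rinv_0_lt_compat; nra].
Qed.

Lemma counted_on_grid_once th eps eta T m x y u v :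
  0 <= eta -> 1 <= m -> eps * m <= eta * (m + 1) -> 0 <= x <= m -> x + 1 <= y ->
  counted th eps eta (T * (1 + x / m)) u v -> ~ counted th eps eta (T * (1 + y / m)) u v.
Proof.
  intros Heta hm Hratio hx hy Hx Hy.
  pose proof (counted_scale_gap _ _ _ _ _ _ _ Hx Hy) as Hgap.
  pose proof (grid_growth T m x y hm hx hy) as Hgrowth.
  set (Bx := T * (1 + x / m)) in *. set (By := T * (1 + y / m)) in *.
  assert (Bx * Bx * eps * m <= By * By * eta * m) by nra.
  nra.
Qed.

Lemma counted_in_dyadic_range_length th eps eta T (l : list (Z * Z)) :
  NoDup l ->
  (forall u v, In (u, v) l -> exists B, T <= B <= 2 * T /\ counted th eps eta B u v) ->
  (length l <= Z.to_nat (up (8 * eps)))%nat.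
Proof.
  intros Hnd Hl. replace (8 * eps) with (2 * (4 * eps)) by ring.
  apply (near_coprime_fractions_length th (2 * T)); [exact Hnd|].
  intros u v Hin. destruct (Hl u v Hin) as (B & [HTB HB2T] & g & hv & _ & HvB & _ & Hd).
  assert (Hscale : Rabs (IZR u / IZR v - th) * (T * T) <= Rabs (IZR u / IZR v - th) * (B * B))
    by (apply Rmult_le_compat_l; [apply Rabs_pos | nra]).
  repeat split; [assumption | assumption | lra | nra].
Qed.

Lemma counted_pairs_nil_frequently th eps eta :
  0 <= eta -> eta < eps -> (eps - eta) * (8 * eps + 1) <= eta ->
  forall T0, exists B, T0 <= B /\ counted_pairs th eps eta B = nil.
Proof.
  intros Heta Hlt Hclose T0.
  set (T := Rmax T0 1).
  assert (HT0 : T0 <= T) by apply Rmax_l. assert (HT : 1 <= T) by apply Rmax_r.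
  set (M := Z.to_nat (up (8 * eps))).
  assert (HM : 1 <= INR M <= 8 * eps + 1).
  { destruct (archimed (8 * eps)).
    assert (Hup : (0 < up (8 * eps))%Z) by (apply lt_IZR; lra).
    assert (1 <= IZR (up (8 * eps))) by (apply IZR_le; lia).
    unfold M. rewrite INR_IZR_INZ, Z2Nat.id by lia. lra. }
  assert (Hratio : eps * INR M <= eta * (INR M + 1)).
  { assert ((eps - eta) * INR M <= (eps - eta) * (8 * eps + 1))
      by (apply Rmult_le_compat_l; lra).
    lra. }
  set (Bj := fun j : nat => T * (1 + INR j / INR M)).
  assert (HBj : forall j, (j <= M)%nat -> T <= Bj j <= 2 * T).
  { intros j hj. apply le_INR in hj.
    assert (0 <= INR j / INR M <= 1).
    { split; [apply Rmult_le_pos; [apply pos_INR | left; apply Rinv_0_lt_compat; lra]|].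
      apply (Rmult_le_reg_r (INR M)); [lra|]. field_simplify; lra. }
    unfold Bj. nra. }
  apply NNPP. intros Hnone.
  set (p := fun j => hd (0%Z, 0%Z) (counted_pairs th eps eta (Bj j))).
  assert (Hp : forall j, (j <= M)%nat -> In (p j) (counted_pairs th eps eta (Bj j))).
  { intros j hj. unfold p.
    destruct (counted_pairs th eps eta (Bj j)) as [|q l] eqn:E; [|left; reflexivity].
    exfalso. apply Hnone. exists (Bj j). split; [pose proof (HBj j hj); lra | exact E]. }
  assert (Hdistinct : forall j j', (j < j' <= M)%nat -> p j <> p j').
  { intros j j' hjj' E.
    pose proof (Hp j ltac:(lia)) as Hj. pose proof (Hp j' ltac:(lia)) as Hj'.
    rewrite <- E in Hj'. destruct (p j) as [u v].
    apply In_counted_pairs in Hj, Hj'.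
    assert (Hx : 0 <= INR j <= INR M) by (split; [apply pos_INR | apply le_INR; lia]).
    assert (Hy : INR j + 1 <= INR j') by (rewrite <- S_INR; apply le_INR; lia).
    exact (counted_on_grid_once th eps eta T (INR M) (INR j) (INR j') u v
             Heta (proj1 HM) Hratio Hx Hy Hj Hj'). }
  assert (Hlen : (length (map p (seq 0 (S M))) <= M)%nat).
  { apply (counted_in_dyadic_range_length th eps eta T).
    - apply NoDup_map_NoDup_ForallPairs; [|apply seq_NoDup].
      intros j j' Hj Hj' E. apply in_seq in Hj, Hj'.
      destruct (Nat.lt_total j j') as [lt|[eq|lt]]; [exfalso | exact eq | exfalso].
      + apply (Hdistinct j j'); [lia | exact E].
      + apply (Hdistinct j' j); [lia | symmetry; exact E].
    - intros u v Hin. apply in_map_iff in Hin. destruct Hin as [j [Ej Hj]].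
      apply in_seq in Hj. exists (Bj j). split; [apply HBj; lia|].
      apply In_counted_pairs. rewrite <- Ej. apply Hp. lia. }
  rewrite length_map, length_seq in Hlen. lia.
Qed.

Lemma le_sqrt_div_of_mul_le (x d eps : R) : 0 < d -> x * x * d <= eps -> Rabs x <= sqrt (eps / d).
Proof.
  intros Hd Hx. apply Rabs_le_sqrt. apply (Rmult_le_reg_r d); [exact Hd|].
  replace (eps / d * d) with eps by (field; lra). exact Hx.
Qed.

Lemma counted_at_critical_scale th eps eta u v :
  Z.gcd u v = 1%Z -> (1 <= v)%Z -> eta < eps -> 0 < Rabs (IZR u / IZR v - th) ->
  IZR u * IZR u * Rabs (IZR u / IZR v - th) <= eps ->
  IZR v * IZR v * Rabs (IZR u / IZR v - th) <= eps ->
  counted th eps eta (sqrt (eps / Rabs (IZR u / IZR v - th))) u v.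
Proof.
  intros G hv Hlt Hd0 Hu Hv.
  assert (Hv1 : 1 <= IZR v) by (apply IZR_le; exact hv).
  set (d := Rabs (IZR u / IZR v - th)) in *.
  assert (HBB : sqrt (eps / d) * sqrt (eps / d) = eps / d).
  { apply sqrt_sqrt. apply Rmult_le_pos; [nra | left; apply Rinv_0_lt_compat, Hd0]. }
  repeat split.
  - exact G.
  - exact hv.
  - apply le_sqrt_div_of_mul_le; assumption.
  - rewrite <- (Rabs_right (IZR v)) by lra. apply le_sqrt_div_of_mul_le; assumption.
  - fold d. rewrite HBB. replace (d * (eps / d)) with eps by (field; lra). lra.
  - fold d. rewrite HBB. replace (d * (eps / d)) with eps by (field; lra). lra.
Qed.

Lemma counted_pairs_nonempty_frequently th eps eta :
  (forall p q : Z, (0 < q)%Z -> IZR p / IZR q <> th) ->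
  (Rabs th + 1) * (Rabs th + 1) <= eps -> eta < eps ->
  forall M, exists B, M <= B /\ counted_pairs th eps eta B <> nil.
Proof.
  intros Hirr Heps Hlt M.
  assert (Heps1 : 1 <= eps) by (pose proof (Rabs_pos th); nra).
  destruct (INR_unbounded (M * M / eps)) as [n0 Hn0].
  set (n := S n0).
  assert (Hn : M * M / eps < INR n /\ 1 <= INR n).
  { unfold n. rewrite S_INR. pose proof (pos_INR n0). lra. }
  destruct (dirichlet_approx_coprime th n ltac:(unfold n; lia)) as (u & v & G & hv & Happ).
  assert (Hv : 1 <= IZR v <= INR n).
  { split; [apply IZR_le; lia | rewrite INR_IZR_INZ; apply IZR_le; lia]. }
  set (d := Rabs (IZR u / IZR v - th)).
  assert (Hdv : d * IZR v = Rabs (IZR v * th - IZR u)).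
  { replace (IZR v * th - IZR u) with (- ((IZR u / IZR v - th) * IZR v)) by (field; lra).
    rewrite Rabs_Ropp, Rabs_mult, (Rabs_right (IZR v)) by lra. reflexivity. }
  assert (Hd0 : 0 < d).
  { apply Rabs_pos_lt. intros E. apply (Hirr u v); [lia | lra]. }
  assert (Hdvn : d * IZR v * INR n < 1).
  { apply (Rmult_lt_reg_r (/ INR n)); [apply Rinv_0_lt_compat; lra | field_simplify; lra]. }
  assert (Hdn : d * INR n < 1) by nra.
  assert (Hdvv : d * (IZR v * IZR v) < 1) by nra.
  exists (sqrt (eps / d)). split.
  - apply Rle_trans with (Rabs M); [apply Rle_abs | apply le_sqrt_div_of_mul_le; [exact Hd0|]].
    assert (M * M < eps * INR n).
    { apply (Rmult_lt_reg_r (/ eps)); [apply Rinv_0_lt_compat; lra|].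
      replace (eps * INR n * / eps) with (INR n) by (field; lra). lra. }
    nra.
  - intros E. apply (in_nil (a := (u, v))). rewrite <- E. apply In_counted_pairs.
    assert (Hfrac : Rabs (IZR u / IZR v) <= Rabs th + 1).
    { replace (IZR u / IZR v) with (th + (IZR u / IZR v - th)) by ring.
      pose proof (Rabs_triang th (IZR u / IZR v - th)) as Htri. fold d in Htri. nra. }
    assert (Hsq : (IZR u / IZR v) * (IZR u / IZR v) <= (Rabs th + 1) * (Rabs th + 1)).
    { apply Rsqr_le_abs_1.
      rewrite (Rabs_right (Rabs th + 1)) by (pose proof (Rabs_pos th); lra). exact Hfrac. }
    apply counted_at_critical_scale; fold d; [exact G | lia | exact Hlt | exact Hd0 | | lra].
    replace (IZR u * IZR u * d) with
      ((IZR u / IZR v) * (IZR u / IZR v) * (d * (IZR v * IZR v))) by (field; lra).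
    assert (0 <= (IZR u / IZR v) * (IZR u / IZR v)) by nra.
    nra.
Qed.

Theorem mainTheorem6 (a b : Z) (ha : (0 < a)%Z) (hab : (a < b)%Z)
  (hcop : Z.gcd a b = 1%Z)
  (hsq : ~ ((exists x : Z, a = (x * x)%Z) /\ (exists y : Z, b = (y * y)%Z))) :
  forall C D : R, 0 < C -> 0 < D ->
  exists eps eta : R, C < eta /\ eta < eps /\ eps - eta < D /\
    liminf_infty_eq (fun B => delta (sqrt (IZR b / IZR a)) B (1 / 2) (chi eps eta)) 0 /\
    exists L : R, 0 < L /\
      limsup_infty_eq (fun B => delta (sqrt (IZR b / IZR a)) B (1 / 2) (chi eps eta)) L.
Proof.
  intros C D hC hD.
  set (th := sqrt (IZR b / IZR a)).
  assert (Hirr : forall p q : Z, (0 < q)%Z -> IZR p / IZR q <> th)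
    by (apply sqrt_ratio_irrational; auto; lia).
  set (eta := Rmax C ((Rabs th + 1) * (Rabs th + 1)) + 1).
  set (eps := eta + Rmin (D / 2) (1 / 20)).
  assert (Heta : C < eta /\ (Rabs th + 1) * (Rabs th + 1) < eta /\ 1 <= eta).
  { pose proof (Rmax_l C ((Rabs th + 1) * (Rabs th + 1))).
    pose proof (Rmax_r C ((Rabs th + 1) * (Rabs th + 1))).
    pose proof (Rabs_pos th). unfold eta. nra. }
  assert (Hgap : 0 < eps - eta <= D / 2 /\ eps - eta <= 1 / 20).
  { unfold eps. replace (eta + Rmin (D / 2) (1 / 20) - eta) with (Rmin (D / 2) (1 / 20)) by ring.
    split; [split; [apply Rmin_glb_lt; lra | apply Rmin_l] | apply Rmin_r]. }
  set (count := fun B => length (counted_pairs th eps eta B)).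
  exists eps, eta. split; [lra|]. split; [lra|]. split; [lra|]. split.
  - apply (liminf_zero_of_nat_valued _ count); [intros B; apply delta_chi_length|].
    intros M. destruct (counted_pairs_nil_frequently th eps eta) with (T0 := M)
      as [B [hB E]]; [lra | lra | nra | ].
    exists B. split; [exact hB|]. unfold count. rewrite E. reflexivity.
  - apply (limsup_pos_of_nat_valued _ count (Z.to_nat (up (2 * eps)))).
    + intros B. apply delta_chi_length.
    + intros B. apply counted_pairs_length_le.
    + intros M. destruct (counted_pairs_nonempty_frequently th eps eta Hirr) with (M := M)
        as [B [hB Hne]]; [lra | lra |].
      exists B. split; [exact hB|]. unfold count.
      destruct (counted_pairs th eps eta B); [contradiction | simpl; lia].
Qed.
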